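(* Let $p$ be a prime and let $q=p^n$ with $n\ge 1$. Let $D \subset \mathbb{F}_q^*$ satisfy $|DD^{-1}D^{-1}|\leq \frac{q+1}{2}$. Then $D=\mathcal{D}_f$ for some function $f: \mathbb{F}_q \to \mathbb{F}_q$ with $f(0)=0$ if and only if $D=aK$ for some $a \in \mathbb{F}_q^*$ and some subgroup $K$ of $\mathbb{F}_{q}^*$ with index $p^r-1$, where $r$ is a (positive) divisor of $n$.
   Context: $\mathbb{F}_q$ denotes the finite field with $q$ elements and $\mathbb{F}_q^*=\mathbb{F}_q\setminus\{0\}$ is its multiplicative group. For subsets $A,B\subset \mathbb{F}_q^*$, write $AB=\{ab: a\in A, b\in B\}$ and $A^{-1}=\{a^{-1}: a\in A\}$; thus $DD^{-1}D^{-1}=\{d_1d_2^{-1}d_3^{-1}: d_1,d_2,d_3\in D\}$. For $a\in\mathbb{F}_q^*$, $aK=\{ak: k\in K\}$. For a function $f:\mathbb{F}_q\to\mathbb{F}_q$, the set of directions determined by $f$ is $$\mathcal{D}_f=\left\{\frac{f(x)-f(y)}{x-y}: x,y\in\mathbb{F}_q,\ x\neq y\right\}\subset\mathbb{F}_q.$$ *)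

(* Defs.v *)
From HB Require Import structures.
From mathcomp Require Import all_boot all_order all_algebra all_fingroup.

Set Implicit Arguments.
Unset Strict Implicit.
Unset Printing Implicit Defensive.

Import GRing.Theory.
Local Open Scope ring_scope.

Definition directions (F : finFieldType) (f : F -> F) : {set F} :=
  [set (f xy.1 - f xy.2) / (xy.1 - xy.2) | xy : F * F & xy.1 != xy.2].

(* A subset of F^* is a set in the finite group {unit F}, so that products,
   inverses and cosets of subsets are those of the group library; this is the
   underlying subset of F. *)
Definition units_in_field (F : finFieldType) (D : {set {unit F}}) : {set F} :=
  [set FinRing.uval u | u in D].

(* Main.v *)
Require Import Defs.
From HB Require Import structures.
From mathcomp Require Import all_boot all_order all_algebra all_fingroup.
From mathcomp Require Import all_solvable all_field ring.

Set Implicit Arguments.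
Unset Strict Implicit.
Unset Printing Implicit Defensive.

Import GRing.Theory.
Local Open Scope ring_scope.

(** Let f determine at most (q+1)/2 directions, with f(0) = 0. The Redei
    polynomials prod_x (X - (f(x) - x y)) are lacunary and fully reducible, so
    each of them is X^q - X or has zero derivative. Hence all the power sums
    sum_x (f(x) - x y)^k with k < q-1 vanish, and the reduced polynomial of f
    has only exponents divisible by p, besides 1; writing X^q for X, f is
    induced by a polynomial P of degree at most q with P' = 0.

    The directions of x |-> 1/f(1/x) lie in D D^-1 D^-1, so the same applies to
    it: this gives a polynomial V of degree < q with V' = 0 and
    V(x) = x^q / f(x) for x <> 0. Then P V - X^q vanishes on F_q, has zero
    derivative and degree < 2q, which forces P V = X^q, and P = c X^M.
    Applied to the translates P(X + z) - P(z), this shows that x |-> x^M is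
    additive. Thus D is c times the group of (M-1)-th powers, whose index is
    the number of nonzero fixed points of the automorphism x |-> x^M. *)

(** * Power sums and products of linear factors over a finite field *)

Lemma natr_card_eq0 (F : finFieldType) : #|F|%:R = 0 :> F.
Proof.
(* Translation by 1 permutes [F]. *)
have /eqP : \sum_(x : F) (x + 1) = \sum_(x : F) x.
  by rewrite [RHS](reindex_inj (addIr 1)).
by rewrite big_split /= sumr_const -subr_eq0 addrAC subrr add0r => /eqP.
Qed.

(** For k > 0, X^k - 1 has at most k < q-1 roots, so some nonzero [a] has a^k != 1; multiplication
    by [a] permutes [F] and scales the sum by a^k. *)
Lemma sum_expr_eq0 (F : finFieldType) (k : nat) :
  (k < #|F|.-1)%N -> \sum_(x : F) x ^+ k = 0.
Proof.
case: k => [_|k kF]; first by under eq_bigr do rewrite expr0;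
  rewrite sumr_const natr_card_eq0.
have [a a0 ak] : exists2 a : F, a != 0 & a ^+ k.+1 != 1.
  apply/exists_inP; apply: contraTT kF => /exists_inPn roots1.
  rewrite -leqNgt -card_finField_unit cardE.
  rewrite -(size_map FinRing.uval); apply: max_unity_roots => //.
    apply/allP => _ /mapP[u _ ->]; rewrite unity_rootE.
    by apply/negPn/roots1; rewrite -topredE /= -unitfE (valP u).
  by rewrite map_inj_uniq ?enum_uniq //; exact: val_inj.
have /eqP : \sum_(x : F) x ^+ k.+1 = a ^+ k.+1 * \sum_(x : F) x ^+ k.+1.
  rewrite mulr_sumr [LHS](reindex_inj (mulfI a0)).
  by apply: eq_bigr => x _; rewrite exprMn.
rewrite -[X in X == _]mul1r -subr_eq0 -mulrBl mulf_eq0 subr_eq0 eq_sym.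
by rewrite (negPf ak) => /eqP.
Qed.

(** Every root multiplicity vanishes in [F]: write the product as (X - v)^mu Q with Q(v) != 0,
    cancel (X - v)^(mu-1) from the derivative and evaluate at v. The sum then splits into terms mu
    h(v). *)
Lemma sum_eq0_of_deriv_eq0 (F : finFieldType) (T : finType) (c : T -> F)
    (h : F -> F) :
  (\prod_x ('X - (c x)%:P))^`() = 0 -> \sum_x h (c x) = 0.
Proof.
move=> dR; rewrite (partition_big c predT) //= big1 // => v _.
rewrite (eq_bigr (fun=> h v)) => [|x /eqP -> //].
rewrite sumr_const -mulr_natr; set mu := #|_|.
suff -> : mu%:R = 0 :> F by rewrite mulr0.
have := dR; rewrite (bigID (fun x => c x == v)) /=.
rewrite (eq_bigr (fun=> 'X - v%:P)) => [|x /eqP -> //].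
rewrite prodr_const -/mu; set Q := \prod_(_ | _) _.
case: mu => [|mu] //.
rewrite derivM deriv_exp derivXsubC mul1r -pred_Sn.
have -> (A : {poly F}) : A ^+ mu *+ mu.+1 * Q + A ^+ mu.+1 * Q^`() =
    A ^+ mu * (Q *+ mu.+1 + A * Q^`()).
  by rewrite mulrDr mulrnAl mulrnAr mulrA -exprSr.
move/eqP; rewrite mulf_eq0 expf_eq0 polyXsubC_eq0 andbF /=.
move=> /eqP/(congr1 (horner^~ v)); rewrite !hornerE subrr mul0r addr0.
rewrite hornerMn -mulr_natl => /eqP; rewrite mulf_eq0 => /orP[/eqP //|].
rewrite horner_prod prodf_seq_eq0 => /hasP[x _ /andP[cx]].
by rewrite !hornerE subr_eq0 eq_sym (negPf cx).
Qed.

Lemma coef_prod_XaddC (R : comNzRingType) (T : finType) (c : T -> R) (j : nat) :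
  (j <= #|T|)%N ->
  (\prod_x ('X + (c x)%:P))`_(#|T| - j) =
  \sum_(J : {set T} | #|J| == j) \prod_(x in J) c x.
Proof.
move=> jT; under eq_bigr do rewrite addrC.
rewrite bigA_distr coef_sum [RHS]big_mkcond; apply: eq_bigr => J _.
rewrite (bigID (mem J)) /=.
rewrite (eq_bigr (fun x => (c x)%:P)) => [|x -> //].
rewrite [X in _ * X](eq_bigr (fun=> 'X)) => [|x /negPf -> //].
rewrite -rmorph_prod prodr_const coefCM coefXn.
have -> : #|[pred x | x \notin J]| = (#|T| - #|J|)%N.
  by rewrite -(cardC J) addKn; apply: eq_card => x; rewrite !inE.
have -> : (#|T| - j == #|T| - #|J|)%N = (#|J| == j).
  have leJ := max_card J.
  by rewrite -(eqn_add2r (j + #|J|)) addnA subnK // addnCA subnK // addnC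
    eqn_add2r.
by case: eqP => _; rewrite ?mulr1 ?mulr0.
Qed.

(** Some [a x] may be zero, hence an upper bound on the size rather than its value. *)
Lemma size_coef_prod_linear (R : comNzRingType) (T : Type) (a b : T -> R) (s : seq
  T) :
  let P := \prod_(x <- s) (a x *: 'X - (b x)%:P) in
  (size P <= (size s).+1)%N /\ P`_(size s) = \prod_(x <- s) a x.
Proof.
elim: s => [|x s [IHs IHc]] /=; first by rewrite !big_nil size_poly1 coef1.
rewrite !big_cons; set P := \prod_(_ <- s) _ in IHs IHc *.
rewrite mulrBl -scalerAl ['X * P]mulrC mul_polyC; split.
  rewrite (leq_trans (size_polyD _ _)) // geq_max size_polyN; apply/andP; split.
    rewrite (leq_trans (size_scale_leq _ _)) // (leq_trans (size_polyMleq _ _))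
      //.
    by rewrite size_polyX addn2.
  by rewrite (leq_trans (size_scale_leq _ _)) // leqW.
rewrite coefB !coefZ coefMX /= IHc.
by rewrite [P`__]nth_default // mulr0 subr0.
Qed.

(** Differentiation lowers the multiplicity of a root by at most one, and X^q - X, which vanishes on
    all of [F], restores the lost factor. *)
Lemma dvdp_prod_deriv (F : finFieldType) (s : seq F) :
  \prod_(a <- s) ('X - a%:P) %|
    ('X^#|F| - 'X) * (\prod_(a <- s) ('X - a%:P))^`().
Proof.
elim: s => [|a s IHs]; first by rewrite big_nil dvd1p.
rewrite big_cons derivM derivXsubC mul1r mulrDr dvdp_add //; last first.
  by rewrite mulrCA dvdp_mul2l // polyXsubC_eq0.
by rewrite dvdp_mul // finField_genPoly (bigD1 a) //= dvdp_mulr.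
Qed.

Lemma card_finField_gt1 (F : finFieldType) : (1 < #|F|)%N.
Proof. by rewrite (cardD1 0) (cardD1 1) !inE oner_neq0. Qed.

Lemma deriv_Xcard (F : finFieldType) : 'X^#|F|^`() = 0 :> {poly F}.
Proof. by rewrite derivXn -mulr_natr -polyC_natr natr_card_eq0 mulr0. Qed.

Lemma prod_XsubC_codom (R : comNzRingType) (T : finType) (c : T -> R) :
  \prod_x ('X - (c x)%:P) = \prod_(a <- codom c) ('X - a%:P).
Proof. by rewrite big_image. Qed.

(* Redei's theorem on fully reducible lacunary polynomials: with R = X^q + g,
   R divides (X + g) g', which is of lower degree than R. *)
Lemma lacunary_prod (F : finFieldType) (c : F -> F) (m : nat) :
  let R : {poly F} := \prod_x ('X - (c x)%:P) in
  (1 < m)%N -> (m + m <= #|F|.+2)%N -> (size (R - 'X^#|F|)%R <= m)%N ->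
  injective c \/ R^`() = 0.
Proof.
move=> R m1 mF; set g := R - _ => sg.
have RE : R = \prod_(a <- codom c) ('X - a%:P) by exact: prod_XsubC_codom.
have dR : R^`() = g^`() by rewrite /g derivB deriv_Xcard subr0.
have sR : size R = #|F|.+1 by rewrite RE size_prod_XsubC size_codom.
have : R %| ('X + g) * g^`().
  have -> : ('X + g) * g^`() = R * g^`() - ('X^#|F| - 'X) * R^`().
    by rewrite dR -mulrBl /g opprB addrCA.
  apply: dvdp_sub; first exact: dvdp_mulr.
  by rewrite RE dvdp_prod_deriv.
case: (eqVneq g^`() 0) => [dg0 _|dg0]; first by right; rewrite dR.
(* If X + g = 0, then R = X^q - X has derivative -1, so its roots, the values of [c], are
   distinct. *)
case: (eqVneq ('X + g) 0) => [g0 _|g0 dvdR].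
  left; apply/injectiveP; rewrite /injectiveb /dinjectiveb.
  rewrite -[uniq _](separable_prod_XsubC (codom c)) -RE separable_poly.unlock
    dR.
  have -> : g = - 'X by apply/eqP; rewrite -addr_eq0 addrC g0.
  by rewrite derivN derivX -scaleN1r coprimepZr ?coprimep1 // oppr_eq0 oner_eq0.
have := dvdp_leq (mulf_neq0 g0 dg0) dvdR.
rewrite sR leqNgt => /negP[]; rewrite ltnS size_mul //.
have sXg : (size ('X + g)%R <= m)%N.
  by rewrite (leq_trans (size_polyD _ _)) // geq_max size_polyX m1.
have sdg : (size g^`() < m)%N.
  apply: leq_trans (lt_size_deriv _) sg.
  by apply: contraNneq dg0 => ->; rewrite deriv0.
have := leq_add sXg sdg; rewrite addnS => /leq_trans/(_ mF).
by rewrite ltnS -subn1 leq_subLR add1n.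
Qed.

(** * Directions and Redei polynomials *)

Lemma directionsP (F : finFieldType) (f : F -> F) (y : F) :
  reflect (exists x z, x != z /\ y = (f x - f z) / (x - z))
    (y \in directions f).
Proof.
apply: (iffP imsetP) => [[[x z]]|[x [z [xz ->]]]]; last by exists (x, z);
  rewrite ?inE.
by rewrite inE /= => xz ->; exists x, z.
Qed.

Lemma inj_sub_of_notin_directions (F : finFieldType) (f : F -> F) (y : F) :
  y \notin directions f -> injective (fun x => f x - x * y).
Proof.
move=> yD x z E; apply: contraNeq yD => xz; apply/directionsP.
exists x, z; split=> //.
apply: (@mulfI _ (x - z)); first by rewrite subr_eq0.
rewrite mulrCA mulfV ?subr_eq0 // mulr1 mulrBl.
by move/eqP: E; rewrite subr_eq => /eqP ->; ring.
Qed.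

(** For 2 <= i < q, the coefficient of X^i is a polynomial in y of degree less than q-i. It vanishes
    at each of the q-N non-directions, where the product is X^q - X; so it is zero as soon as i >=
    N, and the product is lacunary. *)
Lemma inj_or_deriv_eq0 (F : finFieldType) (f : F -> F) (y : F) :
  (2 * #|directions f| <= #|F|.+1)%N ->
  injective (fun x => f x - x * y) \/
  (\prod_x ('X - (f x - x * y)%:P))^`() = 0.
Proof.
move=> few; set N := #|_| in few.
have F1 := card_finField_gt1 F.
(* The 2 leaves room for the term -X of X^q - X. *)
apply: (@lacunary_prod _ _ (maxn N 2)); first by rewrite leq_maxr.
  rewrite /maxn; case: ifP => _ //; rewrite addnn -mul2n.
  exact: leq_trans few _.
apply/leq_sizeP => i; rewrite geq_max => /andP[Ni i2].
rewrite coefB coefXn.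
set R := \prod_x _.
have sR : size R = #|F|.+1.
  by rewrite /R prod_XsubC_codom size_prod_XsubC size_codom.
have monR : R \is monic by apply: monic_prod => x _; exact: monicXsubC.
case: (ltngtP i #|F|) => [iF|iF|->]; last first.
- by move/eqP: (monicP monR); rewrite lead_coefE sR /= => /eqP->; rewrite subrr.
- by rewrite nth_default ?sR // subrr.
rewrite subr0; pose j := (#|F| - i)%N.
have ji : i = (#|F| - j)%N by rewrite subKn // ltnW.
have jF : (j <= #|F|)%N by rewrite leq_subr.
pose L x : {poly F} := x *: 'X - (f x)%:P.
pose e := \sum_(J : {set F} | #|J| == j) \prod_(x in J) L x.
have eE z : (\prod_x ('X - (f x - x * z)%:P))`_i = e.[z].
  rewrite ji /e horner_sum; under eq_bigr => x _ do rewrite -polyCN opprB.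
  rewrite coef_prod_XaddC //; apply: eq_bigr => J _.
  rewrite horner_prod; apply: eq_bigr => x _.
  by rewrite !hornerE.
rewrite /R eE; suff -> : e = 0 by rewrite horner0.
have LJ (J : {set F}) : #|J| = j ->
    (size (\prod_(x in J) L x)%R <= j.+1)%N /\ (\prod_(x in J) L x)`_j =
      \prod_(x in J) x.
  move=> <-; rewrite -!big_enum cardE; exact: size_coef_prod_linear.
(* The coefficient of y^j in [e] is that of X^i in the product of all X + x, which is X^q - X. *)
have ej : e`_j = 0.
  rewrite coef_sum (eq_bigr (fun J : {set F} => \prod_(x in J) x)) => [|J
    /eqP/LJ[] //].
  rewrite -coef_prod_XaddC //.
  rewrite (reindex_inj oppr_inj) /=.
  under eq_bigr do rewrite polyCN.
  rewrite -finField_genPoly coefB coefXn coefX -ji.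
  by rewrite (ltn_eqF iF) (gtn_eqF i2) subrr.
have se : (size e <= j)%N.
  apply/leq_sizeP => k; rewrite leq_eqVlt => /predU1P[<- //|jk].
  rewrite coef_sum big1 // => J /eqP/LJ[sJ _].
  by rewrite nth_default // (leq_trans sJ).
apply/eqP; apply: contraLR se => e0; rewrite -ltnNge.
have : (#|~: directions f| < size e)%N.
  rewrite cardE; apply: max_poly_roots => //; last exact: enum_uniq.
  apply/allP => z; rewrite mem_enum inE => /inj_sub_of_notin_directions zinj.
  have prodE : \prod_x ('X - (f x - x * z)%:P) = \prod_(x : F) ('X - x%:P).
    by rewrite [RHS](reindex_inj zinj).
  rewrite rootE -eE prodE -finField_genPoly coefB coefXn coefX.
  by rewrite (ltn_eqF iF) (gtn_eqF i2) subrr.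
apply: leq_trans; rewrite ltnS cardsCs setCK.
by rewrite leq_sub2l.
Qed.

Lemma sum_slope_expr_eq0 (F : finFieldType) (f : F -> F) (y : F) (k : nat) :
  (2 * #|directions f| <= #|F|.+1)%N -> (k < #|F|.-1)%N ->
  \sum_x (f x - x * y) ^+ k = 0.
Proof.
move=> few kF; case: (inj_or_deriv_eq0 y few) => [inj|dR].
  by have := sum_expr_eq0 kF; rewrite (reindex_inj inj).
exact: (sum_eq0_of_deriv_eq0 (fun z => z ^+ k) dR).
Qed.

(** The k-th power sum of f(x) - x y is a polynomial in y of degree at most k < q with q roots,
    hence zero. Up to sign, the expression here is its coefficient of y^(k-1). *)
Lemma sum_mul_expr_eq0 (F : finFieldType) (f : F -> F) (k : nat) :
  (2 * #|directions f| <= #|F|.+1)%N -> (0 < k < #|F|.-1)%N ->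
  k%:R * \sum_x f x * x ^+ k.-1 = 0.
Proof.
move=> few /andP[k0 kF].
pose a i := \sum_x (f x ^+ (k - i) * (- x) ^+ i) *+ 'C(k, i).
pose P := \poly_(i < k.+1) a i.
have P0 : P = 0.
  apply/eqP/negPn/negP => Pn0.
  have : (size (enum F) < size P)%N.
    apply: max_poly_roots; rewrite ?enum_uniq //.
    apply/allP => y _; rewrite rootE horner_poly.
    apply/eqP; rewrite -[RHS](sum_slope_expr_eq0 y few kF);
      under eq_bigr do rewrite /a mulr_suml.
    rewrite exchange_big; apply: eq_bigr => x _ /=.
    rewrite -mulNr exprDn; apply: eq_bigr => i _.
    by rewrite exprMn mulrnAl mulrA.
  rewrite -cardE ltnNge (leq_trans (size_poly _ _)) //.
  by rewrite (leq_trans kF) // leq_pred.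
have : P`_k.-1 = 0 by rewrite P0 coef0.
rewrite coef_poly ltnS leq_pred /a => E.
apply/eqP; rewrite -[_ == 0]orFb -(signr_eq0 F k.-1) -mulf_eq0; apply/eqP.
rewrite -[RHS]E !mulr_sumr; apply: eq_bigr => x _.
have <- : 'C(k, 1) = 'C(k, k.-1) by rewrite -[RHS]bin_sub ?leq_pred // -subn1
  subKn.
rewrite bin1 -[X in (k - X)%N]subn1 subKn // expr1 [(- x) ^+ _]exprNn
  -mulr_natl.
by ring.
Qed.

Lemma few_directions_poly (F : finFieldType) (f : F -> F) :
  f 0 = 0 -> (2 * #|directions f| <= #|F|.+1)%N ->
  exists P : {poly F}, [/\ (size P <= #|F|.+1)%N, P^`() = 0, P`_0 = 0 &
    forall x, P.[x] = f x].
Proof.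
move=> f0 few; set q := #|F| in few *.
have q1 : (1 < q)%N := card_finField_gt1 F.
(* Interpolation: for nonzero c and x, the sum of c^(q-1-m) x^m over 1 <= m < q is -1 if c = x and 0
   otherwise; the value 0 is covered by [f 0 = 0]. *)
pose a m := - \sum_c f c * c ^+ (q.-1 - m).
(* [sum_mul_expr_eq0] with k = q-m gives m a_m = 0 for m > 1. The remaining term X is traded for
   X^q, the same function with zero derivative. *)
pose d m := if m == 1%N then q else m.
have dq m : (0 < m < q)%N -> (0 < d m <= q)%N.
  by rewrite /d; case: eqP => [_ _|_ /andP[-> /ltnW->] //]; rewrite ltnW /=.
exists (\sum_(1 <= m < q) a m *: 'X^(d m)); split.
- rewrite big_nat_cond; apply: (leq_trans (size_sum _ _ _)).
  apply/bigmax_leqP_seq => m _; rewrite andbT => /dq /andP[_ dm].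
  by rewrite (leq_trans (size_scale_leq _ _)) // size_polyXn.
- rewrite raddf_sum /= big_nat_cond big1 // => m;
    rewrite andbT /d => /andP[m0 mq].
  rewrite derivZ; case: eqP => [_|/eqP m1];
    first by rewrite deriv_Xcard scaler0.
  rewrite derivXn -scaler_nat scalerA; suff -> : a m * m%:R = 0 by rewrite
    scale0r.
  have k0 : (0 < q - m < q.-1)%N.
    by rewrite subn_gt0 mq /= -subn1 ltn_sub2l // ltn_neqAle eq_sym m1.
  have := sum_mul_expr_eq0 few k0.
  rewrite natrB ?(ltnW mq) // natr_card_eq0 sub0r predn_sub /a => E.
  by rewrite mulNr mulrC -mulNr.
- rewrite coef_sum big_nat_cond big1 // => m; rewrite andbT => /dq /andP[dm _].
  by rewrite coefZ coefXn (ltn_eqF dm) mulr0.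
move=> x; rewrite horner_sum.
have -> : \sum_(1 <= m < q) (a m *: 'X^(d m)).[x] = \sum_(1 <= m < q) a m * x
  ^+ m.
  by apply: eq_bigr => m _; rewrite hornerZ hornerXn /d; case: eqP => [->|//];
    rewrite expf_card.
have -> : \sum_(1 <= m < q) a m * x ^+ m =
    - \sum_c f c * \sum_(1 <= m < q) c ^+ (q.-1 - m) * x ^+ m.
  under [in RHS]eq_bigr do rewrite mulr_sumr.
  rewrite exchange_big -sumrN; apply: eq_bigr => m _.
  by rewrite /a mulNr mulr_suml; congr (- _); apply: eq_bigr => c _;
    rewrite mulrA.
have [->|x0] := eqVneq x 0.
  rewrite f0 big1 ?oppr0 // => c _; rewrite big_nat_cond big1 ?mulr0 // => m.
  by rewrite andbT => /andP[m0 _]; rewrite expr0n (gtn_eqF m0) mulr0.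
have expq (z : F) : z != 0 -> z ^+ q.-1 = 1.
  move=> z0; apply: (mulfI z0); rewrite -exprS prednK ?mulr1 ?expf_card //;
    exact: ltnW.
rewrite (bigD1 x) //= [X in _ + X]big1 ?addr0 => [|c cx].
  have -> : \sum_(1 <= m < q) x ^+ (q.-1 - m) * x ^+ m = -1.
    rewrite (eq_big_nat _ _ (F2 := fun=> 1)) => [|m /andP[m0 mq]].
      by rewrite sumr_const_nat natrB ?natr_card_eq0 ?sub0r // ltnW.
    by rewrite -exprD subnK ?expq // -ltnS prednK // ltnW.
  by rewrite mulrN1 opprK.
have [->|c0] := eqVneq c 0; first by rewrite f0 mul0r.
apply/eqP; rewrite mulf_eq0; apply/orP; right.
(* Both (q-1)-th powers are 1, so c - x times the geometric sum is 0. *)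
have := subrXX c x q.-1; rewrite !expq // subrr => /esym/eqP.
rewrite mulf_eq0 subr_eq0 (negPf cx) /= => /eqP E.
rewrite big_add1 big_mkord -[X in _ == X](mulr0 x) -[X in _ == _ * X]E
  mulr_sumr; apply/eqP.
by apply: eq_bigr => i _; rewrite exprS mulrCA subnS predn_sub.
Qed.

(** Write T = K (X^q - X). Then T' = 0 reads K = K' (X^q - X), so a nonzero K has degree at least q
    and T has degree at least 2q. *)
Lemma poly_eq0_of_deriv_vanish (F : finFieldType) (T : {poly F}) :
  T^`() = 0 -> (forall x, T.[x] = 0) -> (size T <= #|F| + #|F|)%N -> T = 0.
Proof.
move=> dT T0 sT.
have F1 := card_finField_gt1 F.
have sq : size ('X^#|F| - 'X : {poly F})%R = #|F|.+1.
  by rewrite size_polyDl ?size_polyXn // size_polyN size_polyX.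
have : 'X^#|F| - 'X %| T.
  rewrite finField_genPoly -big_enum uniq_roots_dvdp ?uniq_rootsE ?enum_uniq //.
  by apply/allP => x _; apply/eqP.
case/dvdpP => K TE; apply/eqP; rewrite TE mulf_eq0; apply/orP; left.
have KE : K = K^`() * ('X^#|F| - 'X).
  move: dT; rewrite TE derivM derivB deriv_Xcard derivX sub0r mulrN1.
  by move/eqP; rewrite subr_eq0 => /eqP.
apply: contraTT sT => K0; rewrite -ltnNge.
have K'0 : K^`() != 0 by apply: contraNneq K0 => K'0; rewrite KE K'0 mul0r.
have nz : 'X^#|F| - 'X != 0 :> {poly F} by rewrite -size_poly_gt0 sq.
rewrite TE size_mul // sq addnS /= ltn_add2r KE size_mul // sq addnS /=.
by rewrite -[X in (X < _)%N]add0n ltn_add2r size_poly_gt0.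
Qed.

(** * The reciprocal function, and reduction to additive monomials *)

Lemma mem_units_in_field (F : finFieldType) (D : {set {unit F}}) (u : {unit F})
  :
  (FinRing.uval u \in units_in_field D) = (u \in D).
Proof. by rewrite mem_imset //; exact: val_inj. Qed.

Lemma card_units_in_field (F : finFieldType) (D : {set {unit F}}) :
  #|units_in_field D| = #|D|.
Proof. by rewrite card_imset //; exact: val_inj. Qed.

Lemma uvalM (F : finFieldType) : {morph @FinRing.uval F : u v / (u * v)%g >-> u
  * v}.
Proof. by []. Qed.

Lemma uvalV (F : finFieldType) : {morph @FinRing.uval F : u / (u^-1)%g >->
  u^-1}.
Proof. by []. Qed.

Lemma uvalX (F : finFieldType) (n : nat) :
  {morph @FinRing.uval F : u / (u ^+ n)%g >-> u ^+ n}.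
Proof. exact: FinRing.val_unitX. Qed.

Lemma uval_neq0 (F : finFieldType) (u : {unit F}) : FinRing.uval u != 0.
Proof. by rewrite -unitfE (valP u). Qed.

(* The convention 0^-1 = 0 makes x |-> (f x^-1)^-1 fix 0. *)
Lemma directions_inv_sub (F : finFieldType) (f : F -> F) (D : {set {unit F}}) :
  f 0 = 0 -> directions f \subset units_in_field D ->
  directions (fun x => (f x^-1)^-1) \subset
    units_in_field (D * D^-1 * D^-1)%g.
Proof.
move=> f0 /subsetP fD.
have slope x z : x != z -> exists2 u, u \in D & f x - f z = FinRing.uval u * (x
  - z).
  move=> xz; have : (f x - f z) / (x - z) \in directions f by
    apply/directionsP; exists x, z.
  by move/fD/imsetP=> [u uD E]; exists u => //; rewrite -E divfK // subr_eq0.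
have slope0 x : x != 0 -> exists2 u, u \in D & f x = FinRing.uval u * x.
  by case/slope=> u uD; rewrite f0 !subr0; exists u.
have memS (u v w : {unit F}) : u \in D -> v \in D -> w \in D ->
    FinRing.uval u / FinRing.uval v / FinRing.uval w \in units_in_field (D *
      D^-1 * D^-1)%g.
  move=> uD vD wD; apply/imsetP; exists (u * v^-1 * w^-1)%g.
    by rewrite !mem_mulg ?memV_invg ?inE ?invgK.
  by rewrite !uvalM !uvalV.
have hE x : x != 0 -> exists2 v, v \in D &
    f x^-1 = FinRing.uval v / x /\ (f x^-1)^-1 = x / FinRing.uval v.
  move=> x0; case: (slope0 x^-1) => [|v vD vE]; first by rewrite invr_eq0.
  by exists v => //; split=> //; rewrite vE invfM invrK mulrC.
(* Chords through 0 have slope 1/v, which is v v^-1 v^-1. *)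
have Dself v : v \in D ->
    (FinRing.uval v)^-1 \in units_in_field (D * D^-1 * D^-1)%g.
  by move=> vD; have := memS v v v vD vD vD; rewrite divff ?uval_neq0 ?mul1r.
apply/subsetP => y /directionsP[x [z [xz ->]]].
have [z0|z0] := eqVneq z 0.
  rewrite z0 in xz *; have [v vD [_ ->]] := hE x xz.
  by rewrite invr0 f0 invr0 !subr0 mulrAC divff ?mul1r ?Dself.
have [x0|x0] := eqVneq x 0.
  have [v vD [_ ->]] := hE z z0.
  by rewrite x0 invr0 f0 invr0 !sub0r invrN mulrNN mulrAC divff ?mul1r ?Dself.
have [v vD [vE ->]] := hE x x0; have [w wD [wE ->]] := hE z z0.
have [|u uD] := slope x^-1 z^-1; first by rewrite (inj_eq invr_inj).
rewrite vE wE => uE.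
(* Here f(1/x) = v/x, f(1/z) = w/z, and u is the slope of [f] between 1/x and 1/z. *)
suff -> : (x / FinRing.uval v - z / FinRing.uval w) / (x - z) =
  FinRing.uval u / FinRing.uval v / FinRing.uval w by apply: memS.
have v0 := uval_neq0 v; have w0 := uval_neq0 w.
have xz0 : x - z != 0 by rewrite subr_eq0.
have -> : x / FinRing.uval v - z / FinRing.uval w =
    - (x * z * (FinRing.uval v / x - FinRing.uval w / z)) / (FinRing.uval v *
        FinRing.uval w).
  by field; rewrite x0 z0 v0 w0.
rewrite uE; field; rewrite x0 z0 v0 w0 xz0 //.
Qed.

(** A companion V with P V = X^q is built from the reciprocal function; a divisor of X^q is a
    monomial. *)
Lemma few_directions_monomial (F : finFieldType) (D : {set {unit F}})
    (P : {poly F}) :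
  (2 * #|(D * D^-1 * D^-1)%g| <= #|F|.+1)%N ->
  P`_0 = 0 -> directions (horner P) \subset units_in_field D ->
  P^`() = 0 -> (size P <= #|F|.+1)%N ->
  exists (c : F) (M : nat), P = c *: 'X^M.
Proof.
move=> small P0 PD dP sP; set q := #|F| in small sP *.
have q0 : (0 < q)%N by apply: ltnW; exact: card_finField_gt1.
have h0 : P.[0] = 0 by rewrite horner_coef0.
have gD := directions_inv_sub h0 PD.
case: (@few_directions_poly _ (fun x => P.[x^-1]^-1)).
- by rewrite invr0 h0 invr0.
- by rewrite (leq_trans _ small) // leq_mul2l -card_units_in_field
    subset_leq_card.
move=> Q [sQ dQ Q0 QE].
(* The reversal X^q Q(1/X). As q = 0 in [F], the exponent q-i vanishes in [F] exactly when i does,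
   so V' = 0 follows from Q' = 0. *)
pose V := \poly_(i < q.+1) Q`_(q - i).
have nQ i : Q`_i * i%:R = 0.
  case: i => [|i]; first by rewrite mulr0.
  by rewrite mulr_natr -coef_deriv dQ coef0.
have dV : V^`() = 0.
  apply/polyP => i; rewrite coef_deriv coef_poly coef0 ltnS.
  case: ifP => iq; last by rewrite mul0rn.
  have /eqP := nQ (q - i.+1)%N; rewrite natrB // natr_card_eq0 sub0r mulrN.
  by rewrite oppr_eq0 mulr_natr => /eqP.
(* The absence of a constant term in Q removes X^q from V, which keeps P V below degree 2q. *)
have sV : (size V <= q)%N.
  apply/leq_sizeP => i iq; rewrite coef_poly ltnS.
  case: ifP => // iq'; have -> : i = q by apply/eqP; rewrite eqn_leq iq iq'.
  by rewrite subnn Q0.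
have VE x : x != 0 -> V.[x] = x ^+ q * (P.[x])^-1.
  move=> x0; rewrite -[x in RHS]invrK -QE (horner_coef_wide _ sQ).
  rewrite /V horner_poly mulr_sumr (reindex_inj rev_ord_inj) /=.
  apply: eq_bigr => i _; have iq : (i <= q)%N by rewrite -ltnS.
  rewrite subSS subKn // invrK exprVn mulrCA exprB ?unitfE //.
have P_neq0 x : x != 0 -> P.[x] != 0.
  move=> x0; apply/eqP => Px.
  have : 0 \in units_in_field D.
    apply: (subsetP PD); apply/directionsP; exists x, 0.
    by rewrite Px h0 subrr mul0r.
  by case/imsetP=> u _ u0; have := uval_neq0 u; rewrite -u0 eqxx.
have PV : P * V = 'X^q.
  apply/eqP; rewrite -subr_eq0; apply/eqP/poly_eq0_of_deriv_vanish.
  - by rewrite derivB derivM dP dV mul0r mulr0 deriv_Xcard addr0 subr0.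
  - move=> x; rewrite !hornerE; have [->|x0] := eqVneq x 0.
      by rewrite h0 mul0r expr0n (gtn_eqF q0) subr0.
    by rewrite VE // mulrCA divff ?P_neq0 // mulr1 subrr.
  rewrite (leq_trans (size_polyD _ _)) // geq_max size_polyN size_polyXn.
  rewrite -[X in _ && X]/(q < q + q)%N -[X in _ && (X < _)%N]addn0 ltn_add2l q0
    andbT.
  by rewrite (leq_trans (size_polyMleq _ _)) // -subn1 leq_subLR add1n -addSn
    leq_add.
have : P %| ('X - 0%:P) ^+ q by rewrite subr0 -PV dvdp_mulr.
case/dvdp_exp_XsubCP => M _; rewrite subr0 => /eqpP[[a b] /andP[a0 b0] /= E].
by exists (b / a), M; rewrite mulrC -scalerA -E scalerA mulVf // scale1r.
Qed.

(** The product set contains the translate D d^-1 d^-1 for any d in D. Thus the bound on it also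
    bounds the number of directions of [f]. *)
Lemma leq_card_mul_inv_inv (gT : finGroupType) (D : {set gT}) :
  (#|D| <= #|(D * D^-1 * D^-1)%g|)%N.
Proof.
have [->|[d dD]] := set_0Vmem D; first by rewrite cards0.
rewrite -(card_rcoset D (d^-1 * d^-1)%g) subset_leq_card // -mulgA mulgS //.
by rewrite sub1set mem_mulg ?inE ?invgK.
Qed.

(** The translate P(X + z) - P(z) satisfies the same hypotheses as P, so it is again a monomial;
    comparing leading terms shows that it equals P. *)
Lemma few_directions_additive (F : finFieldType) (D : {set {unit F}}) (f : F ->
  F) :
  (2 * #|(D * D^-1 * D^-1)%g| <= #|F|.+1)%N ->
  f 0 = 0 -> directions f \subset units_in_field D ->
  exists (c : F) (M : nat), [/\ c != 0, (0 < M)%N, forall x, f x = c * x ^+ M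
    & {morph (fun x : F => x ^+ M) : x z / x + z}].
Proof.
move=> small f0 fD.
have [P [sP dP P0 PE]] : exists P : {poly F}, [/\ (size P <= #|F|.+1)%N, P^`()
  = 0, P`_0 = 0 &
    forall x, P.[x] = f x].
  apply: few_directions_poly => //.
  rewrite (leq_trans _ small) // leq_mul2l (leq_trans _ (leq_card_mul_inv_inv
    D)) //.
  by rewrite -card_units_in_field subset_leq_card.
have fP : directions (horner P) \subset units_in_field D.
  apply: subset_trans fD; apply/subsetP => y /directionsP[x [z [xz ->]]].
  by apply/directionsP; exists x, z; rewrite !PE.
have [c [M PcM]] := few_directions_monomial small P0 fP dP sP.
have c0 : c != 0.
  apply/eqP => c0; have : 0 \in units_in_field D.
    apply: (subsetP fP); apply/directionsP; exists 1, 0.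
    by rewrite oner_neq0 PcM c0 scale0r !horner0 subrr mul0r.
  by case/imsetP=> u _ u0; have := uval_neq0 u; rewrite -u0 eqxx.
have M0 : (0 < M)%N.
  by rewrite lt0n; apply: contra_neq c0 => M0; move: P0;
    rewrite PcM M0 coefZ coef1 mulr1.
have fE x : f x = c * x ^+ M by rewrite -PE PcM !hornerE.
exists c, M; split=> // x z; apply: (mulfI c0).
pose Pz := P \Po ('X + z%:P) - P.[z]%:P.
have PzE y : Pz.[y] = P.[y + z] - P.[z] by rewrite !hornerE horner_comp
  !hornerE.
have [|||| c' [M' PzcM]] := few_directions_monomial (P := Pz) small.
- by rewrite -horner_coef0 PzE add0r subrr.
- apply: subset_trans fP; apply/subsetP => y /directionsP[x1 [z1 [xz ->]]].
  apply/directionsP; exists (x1 + z), (z1 + z).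
  by rewrite (inj_eq (addIr z)) !PzE; split=> //; congr (_ / _); ring.
- by rewrite derivB deriv_comp dP comp_poly0 mul0r derivC subrr.
- rewrite (leq_trans (size_polyD _ _)) // geq_max size_polyN size_comp_poly2
    ?sP.
    by rewrite (leq_trans (size_polyC_leq1 _)).
  by rewrite size_XaddC.
(* This nonzero coefficient identifies both the exponent and the scalar of the monomial [Pz]. *)
have PzM : Pz`_M = c.
  rewrite coefB coefC (gtn_eqF M0) subr0.
  have <- : (size (P \Po ('X + z%:P))).-1 = M.
    by rewrite size_comp_poly2 ?size_XaddC // PcM size_scale // size_polyXn.
  rewrite -[LHS]/(lead_coef _) lead_coef_comp ?size_XaddC //.
  by rewrite lead_coefXaddC expr1n mulr1 PcM lead_coefZ lead_coefXn mulr1.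
move: PzM; rewrite PzcM coefZ coefXn => PzM.
have [MM' c'c] : M = M' /\ c' = c.
  by move: PzM; case: eqP => [-> <-|_ E]; rewrite ?mulr1 //;
    rewrite -E mulr0 eqxx in c0.
have := PzE x; rewrite PzcM -MM' c'c !PE !fE hornerZ hornerXn.
by move/eqP; rewrite eq_sym subr_eq => /eqP /= ->; rewrite mulrDr.
Qed.

(** * Groups of powers, their indices, and fixed points of power maps *)

Lemma units_in_field_inj (F : finFieldType) : injective (@units_in_field F).
Proof. by apply: imset_inj; exact: val_inj. Qed.

Definition unit_powers (F : finFieldType) (k : nat) : {set {unit F}} :=
  [set (u ^+ k)%g | u in [set: {unit F}]].

Lemma mulg_unit_comm (F : finFieldType) (u v : {unit F}) : commute u v.
Proof. by apply: val_inj; apply: mulrC. Qed.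

Lemma abelian_units (F : finFieldType) : abelian [set: {unit F}].
Proof. by apply/centsP => u _ v _; exact: mulg_unit_comm. Qed.

(** The power map is an endomorphism of an abelian group, and the index of its image is the order of
    its kernel. *)
Lemma unit_powers_group (F : finFieldType) (k : nat) :
  exists2 K : {group {unit F}}, K = unit_powers F k :> {set _} &
    #|[set: {unit F}] : K|%g = #|[set u : {unit F} | (u ^+ k)%g == 1%g]|.
Proof.
have expM : {in [set: {unit F}] &, {morph (fun u => u ^+ k)%g : u v / (u *
  v)%g}}.
  by move=> u v _ _ /=; rewrite expgMn //; exact: mulg_unit_comm.
pose phi := Morphism expM.
exists (phi @* [set: {unit F}])%G; first by rewrite /= morphimE setTI.
have -> : [set u : {unit F} | (u ^+ k)%g == 1%g] = ('ker phi)%g.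
  by apply/setP => u; rewrite !inE.
apply/eqP; rewrite -(eqn_pmul2l (cardG_gt0 (phi @* [set: {unit F}])%G))
  Lagrange ?subsetT //.
rewrite card_morphim setTI mulnC Lagrange ?subsetT //.
Qed.

(** By additivity, the slope between x and z is a (x - z)^k. *)
Lemma directions_additive_monomial (F : finFieldType) (a : {unit F}) (k : nat) :
  {morph (fun x : F => x ^+ k.+1) : x z / x + z} ->
  directions (fun x => FinRing.uval a * x ^+ k.+1) =
    units_in_field (a *: unit_powers F k)%g.
Proof.
move=> addM.
have slopeE (x z : F) : x != z -> (FinRing.uval a * x ^+ k.+1 - FinRing.uval a
  * z ^+ k.+1) / (x - z) =
    FinRing.uval a * (x - z) ^+ k.
  move=> xz; have -> : x ^+ k.+1 = (x - z) ^+ k.+1 + z ^+ k.+1 by rewrite -addM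
    subrK.
  by rewrite mulrDr addrK exprSr -!mulrA divff ?mulr1 // subr_eq0.
apply/setP => y; apply/directionsP/imsetP => [[x [z [xz ->]]]|[u]].
  have xz0 : x - z \is a GRing.unit by rewrite unitfE subr_eq0.
  exists (a * FinRing.unit F xz0 ^+ k)%g; last by rewrite slopeE // uvalM uvalX.
  by rewrite mem_lcoset mulKg; apply/imsetP; exists (FinRing.unit F xz0).
rewrite mem_lcoset => /imsetP[v _ E] ->.
exists (FinRing.uval v), 0; rewrite uval_neq0 slopeE ?uval_neq0 //; split=> //.
by rewrite subr0 -uvalX -uvalM -E mulKVg.
Qed.

(** Modulo p^r - 1, p^n is congruent to p^s with s = n mod r. As p^s - 1 < p^r - 1, divisibility
    forces s = 0. *)
Lemma dvdn_of_dvdn_predn_expn (p r n : nat) :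
  (1 < p)%N -> (0 < r)%N -> (p ^ r - 1 %| p ^ n - 1)%N -> (r %| n)%N.
Proof.
move=> p1 r0; have p0 k : (0 < p ^ k)%N by rewrite expn_gt0 ltnW.
rewrite -eqn_mod_dvd // => /eqP E.
have pr1 : (p ^ r = 1 %[mod p ^ r - 1])%N by apply/eqP; rewrite eqn_mod_dvd.
have En : (p ^ n = p ^ (n %% r) %[mod p ^ r - 1])%N.
  rewrite [in LHS](divn_eq n r) expnD [(n %/ r * r)%N]mulnC expnM.
  by rewrite -modnMml -modnXm pr1 modnXm exp1n modnMml mul1n.
have : (p ^ r - 1 %| p ^ (n %% r) - 1)%N by rewrite -eqn_mod_dvd // -En E.
case: (posnP (n %% r)) => [/eqP //|s0 /dvdn_leq].
have lt_s : (p ^ (n %% r) < p ^ r)%N by rewrite ltn_exp2l // ltn_mod.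
have s1 : (1 < p ^ (n %% r))%N by rewrite -(expn0 p) ltn_exp2l.
by rewrite subn_gt0 s1 leqNgt ltn_sub2r ?(ltn_trans s1) // => /(_ isT).
Qed.

(** The fixed points of the additive map x -> x^(k+1) form an additive subgroup, of order p^r by
    Lagrange; the nonzero ones are the u with u^k = 1. Since 1 is among them, r > 0. *)
Lemma card_fixed_expr (F : finFieldType) (p n k : nat) :
  prime p -> #|F| = (p ^ n)%N ->
  {morph (fun x : F => x ^+ k.+1) : x z / x + z} ->
  exists2 r, (0 < r)%N & #|[set u : {unit F} | (u ^+ k)%g == 1%g]| = (p ^ r -
    1)%N.
Proof.
move=> pp cF addM.
pose E := [set x : F | x ^+ k.+1 == x].
have gE : group_set E.
  (* The group law on [F] is addition, so its identity [1%g] is 0. *)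
  apply/group_setP; split=> [|x z]; first by rewrite inE -[1%g]/(0 : F) expr0n.
  rewrite !inE => /eqP xE /eqP zE; rewrite -[(x * z)%g]/(x + z).
  by rewrite addM xE zE.
have : (#|group gE| %| #|[set: F]|)%N by apply: cardSg; exact: subsetT.
rewrite cardsT cF => /(dvdn_pfactor _ _ pp)[r _ /= cE].
have EE : E = 0 |: units_in_field [set u : {unit F} | (u ^+ k)%g == 1%g].
  apply/setP => x; rewrite !inE.
  have [->|x0] := eqVneq x 0; first by rewrite expr0n eqxx.
  rewrite exprS -[X in _ == X]mulr1 (inj_eq (mulfI x0)) /=.
  have xU : x \is a GRing.unit by rewrite unitfE.
  rewrite -[X in X ^+ k]/(FinRing.uval (FinRing.unit F xU)).
  rewrite -[X in _ = (X \in _)]/(FinRing.uval (FinRing.unit F xU)).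
  by rewrite mem_units_in_field inE -uvalX -(inj_eq val_inj).
have cU : #|[set u : {unit F} | (u ^+ k)%g == 1%g]| = (p ^ r - 1)%N.
  rewrite -cE EE cardsU1 card_units_in_field.
  have -> : 0 \notin units_in_field [set u : {unit F} | (u ^+ k)%g == 1%g].
    by apply/imsetP => -[u _ u0]; have := uval_neq0 u; rewrite -u0 eqxx.
  by rewrite addKn.
exists r => //.
have : 1%g \in [set u : {unit F} | (u ^+ k)%g == 1%g] by rewrite inE expg1n.
rewrite lt0n; apply: contraTneq => r0; move/eqP: cU.
by rewrite r0 subnn cards_eq0 => /eqP ->; rewrite inE.
Qed.

(** With m the index, m-th powers die in the quotient by K, hence lie in K. Conversely, the group of
    m-th powers has index the number of m-th roots of unity, at most m, so it is no smaller than
    K. *)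
Lemma unit_powers_index (F : finFieldType) (K : {group {unit F}}) :
  unit_powers F #|[set: {unit F}] : K|%g = K.
Proof.
set m := #|_ : _|%g.
have [K' K'E iK'] := unit_powers_group F m.
have normK : (K <| [set: {unit F}])%g by rewrite -sub_abelian_normal
  ?abelian_units ?subsetT.
have NK u : u \in 'N(K)%g by apply: (subsetP (normal_norm normK)).
apply/eqP; rewrite -K'E eqEcard; apply/andP; split.
  rewrite K'E; apply/subsetP => v /imsetP[u _ ->]; apply: coset_idr => //.
  rewrite morphX //= /m -card_quotient ?normal_norm // expg_cardG //.
  by rewrite mem_quotient.
have m0 : (0 < m)%N by exact: indexg_gt0.
rewrite -(leq_pmul2r m0) (Lagrange (subsetT K)) -(Lagrange (subsetT K'))
  leq_mul2l.
apply/orP; right; rewrite iK' cardE -(size_map FinRing.uval).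
apply: max_unity_roots => //.
  apply/allP => _ /mapP[u + ->]; rewrite mem_enum inE => /eqP um.
  by rewrite unity_rootE -uvalX um.
by rewrite map_inj_uniq ?enum_uniq //; exact: val_inj.
Qed.

Theorem corollary1p3 (F : finFieldType) (p n : nat) (p_prime : prime p)
    (n_ge1 : (1 <= n)%N) (card_F : #|F| = (p ^ n)%N) (D : {set {unit F}})
    (small_DDD : (2 * #|(D * D^-1 * D^-1)%g| <= p ^ n + 1)%N) :
  (exists f : F -> F, f 0 = 0 /\ units_in_field D = directions f) <->
  (exists (a : {unit F}) (K : {group {unit F}}) (r : nat),
     [/\ (0 < r)%N, (r %| n)%N,
         #|[set: {unit F}] : K|%g = (p ^ r - 1)%N
       & D = (a *: K)%g]).
Proof.
have small : (2 * #|(D * D^-1 * D^-1)%g| <= #|F|.+1)%N by rewrite card_F -[(p ^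
  n).+1]addn1.
split=> [[f [f0 Df]]|[a [K [r [r0 rn iK ->]]]]].
  have [|c [M [c0 M0 fE addM]]] := few_directions_additive small f0.
    by rewrite Df.
  case: M M0 fE addM => // k _ fE addM.
  have cU : c \is a GRing.unit by rewrite unitfE.
  have [K KE iK] := unit_powers_group F k.
  have [r r0 cr] := card_fixed_expr p_prime card_F addM.
  exists (FinRing.unit F cU), K, r; split=> //.
  - apply: (dvdn_of_dvdn_predn_expn (prime_gt1 p_prime) r0).
    (* The index p^r - 1 divides the order p^n - 1 of the unit group. *)
    rewrite -cr -iK -card_F subn1 -card_finField_unit; exact: dvdn_indexg.
  - by rewrite iK.
  apply: units_in_field_inj; rewrite KE -directions_additive_monomial // Df.
  by apply: eq_imset => -[x z] /=; rewrite !fE.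
have pF : p \in [pchar F] by apply: card_finPcharP card_F p_prime.
have pr : (p ^ r = (p ^ r - 1).+1)%N by rewrite subn1 prednK // expn_gt0
  prime_gt0.
(* A multiple of an iterated Frobenius map: it is additive, and K consists of the (p^r - 1)-th
   powers. *)
exists (fun x => FinRing.uval a * x ^+ (p ^ r)); split.
  by rewrite expr0n expn_eq0 (gtn_eqF (prime_gt0 p_prime)) mulr0.
have KE := unit_powers_index K; rewrite iK in KE.
have addM : {morph (fun x : F => x ^+ (p ^ r)) : x z / x + z}.
  by move=> x z; rewrite /= exprDn_pchar // pnatX pnatE // pF.
by rewrite -KE -directions_additive_monomial -pr.
Qed.
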